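(* The ring $\mathcal{R}=\frac{GR(p^a,m)[x]}{\langle f(x)\rangle}$ is a local ring with maximal ideal (Jacobson radical) $J(\mathcal{R})=\langle p+\langle f\rangle,\ h(x)+\langle f\rangle\rangle$.
   Context: $p$ is a prime, $a,m\ge 1$; $GR(p^a,m)$ is the Galois ring of characteristic $p^a$ with $p^{am}$ elements, a local ring with maximal ideal $\langle p\rangle$ and residue field $\mathbb{F}_{p^m}$. A bar denotes reduction modulo $p$ (applied coefficientwise to polynomials). $\mathcal{T}_m=\{0,1,\zeta,\dots,\zeta^{p^m-2}\}\subset GR(p^a,m)$ is the Teichmüller set ($\zeta$ of multiplicative order $p^m-1$), identified with $\mathbb{F}_{p^m}$. A polynomial in $GR(p^a,m)[x]$ is regular if it is not a zero divisor (equivalently some coefficient is a unit), primary if it generates a primary ideal, and basic irreducible if it is irreducible and its reduction modulo $p$ is irreducible. Standing assumption: $f(x)\in GR(p^a,m)[x]$ is a monic regular primary polynomial which is not a unit, written as $f(x)=h(x)^t+p\beta(x)$ with $t\ge 1$, $h(x)$ a monic basic irreducible polynomial with $\overline{h}(x)=h(x)$ (i.e. the coefficients of $h$ lie in $\mathcal{T}_m$), $\beta(x)\in GR(p^a,m)[x]$ and $\deg\beta(x)<t\deg h(x)$. *)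

(* Defs.v *)
From HB Require Import structures.
From mathcomp Require Import all_boot all_order all_algebra.
From mathcomp Require Import ring_quotient qpoly boolp.

Set Implicit Arguments.
Unset Strict Implicit.
Unset Printing Implicit Defensive.

Import GRing.Theory.
Local Open Scope ring_scope.

Section RingNotions.
Variable A : comNzRingType.
Implicit Types (x y u v : A) (s : seq A) (I M N : {pred A}).

Definition is_unit x : Prop := exists y, x * y = 1.

Definition irreducible_elt x : Prop :=
  [/\ x <> 0, ~ is_unit x &
      forall u v, x = u * v -> is_unit u \/ is_unit v].

(* [asbool] makes the ideal generated by s a boolean predicate, so that it has
   the type expected by the library's [idealr_closed]. *)
Definition ideal_gen s : {pred A} :=
  fun x => `[< exists c : 'I_(size s) -> A, x = \sum_i c i * s`_i >].

(* [idealr_closed] includes 1 \notin I: it describes proper ideals. *)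
Definition primary_ideal I : Prop :=
  idealr_closed I /\
  forall u v, u * v \in I -> u \in I \/ exists n : nat, v ^+ n.+1 \in I.

Definition maximal_ideal M : Prop :=
  idealr_closed M /\
  forall N, idealr_closed N -> {subset M <= N} -> N =i M.

Definition local_with_maximal_ideal M : Prop :=
  maximal_ideal M /\ forall N, maximal_ideal N -> N =i M.

Definition jacobson_radical : {pred A} :=
  fun x => `[< forall M, maximal_ideal M -> x \in M >].

Definition primary_elt x : Prop := primary_ideal (ideal_gen [:: x]).

End RingNotions.

Arguments jacobson_radical A : clear implicits.

(* These conditions determine R up to isomorphism: R is the Galois ring
   GR(p^a, m).  The first one says that R has characteristic p^a ([pchar R] is
   of no use here, as it only records prime characteristics). *)
Definition galois_ring (p a m : nat) (R : finComNzRingType) : Prop :=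
  [/\ forall k : nat, (k%:R = 0 :> R) <-> (p ^ a %| k)%N,
      #|R| = (p ^ (a * m))%N
    & local_with_maximal_ideal (ideal_gen [:: p%:R : R])].

(* bar presents K as the residue field R / <p>, with p ^ m elements. *)
Definition residue_field (p m : nat) (R : finComNzRingType)
    (K : finFieldType) (bar : {rmorphism R -> K}) : Prop :=
  [/\ #|K| = (p ^ m)%N,
      forall y : K, exists x : R, bar x = y
    & forall x : R, (bar x = 0) <-> (x \in ideal_gen [:: p%:R : R])].

(* {0, 1, zeta, ..., zeta ^ (p ^ m - 2)} *)
Definition teichmuller (R : nzRingType) (p m : nat) (zeta : R) : {pred R} :=
  mem (0 :: [seq zeta ^+ i | i <- iota 0 (p ^ m - 1)]).

Definition basic_irreducible (R : finComNzRingType) (K : finFieldType)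
    (bar : {rmorphism R -> K}) (h : {poly R}) : Prop :=
  irreducible_elt h /\ irreducible_poly (map_poly bar h).

(* Main.v *)
Require Import Defs.
From HB Require Import structures.
From mathcomp Require Import all_boot all_order all_algebra.
From mathcomp Require Import ring_quotient qpoly boolp.

(** Write Q for R[x] / <f>. Two facts make <p, h> its only maximal ideal.

    First, Q / <p, h> is a field. Modulo p, f becomes the power of h with
    exponent t >= 1, so the quotient is K[x] modulo the reduction of h, which
    is irreducible. Concretely, if the reduction of g is a multiple of that of
    h, lifting the cofactor to R[x] puts g in <p, h>; otherwise a Bezout
    relation in K[x] lifts to an inverse of g modulo <p, h>
    ([in_ideal_of_dvd_bar], [inverse_mod_of_ndvd_bar]). The ideal is proper
    because the reduction of h does not divide 1 ([in_ideal_dvd_bar]).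

    Second, p and h are nilpotent in Q: p ^ a = 0, and h ^ t = - p * beta since
    f vanishes. A nilpotent element belongs to every maximal ideal
    ([maximal_ideal_nilpotent]), hence every maximal ideal contains <p, h>,
    and so equals it ([local_of_nilpotent_gens]). In a local ring the
    Jacobson radical is the maximal ideal ([jacobson_local]). *)

Set Implicit Arguments.
Unset Strict Implicit.
Unset Printing Implicit Defensive.

Import GRing.Theory.
Local Open Scope ring_scope.

(** * Maximal ideals and nilpotent elements *)

Section Ideals.
Variable A : comNzRingType.
Implicit Types (x y u v : A) (s : seq A) (M N : {pred A}).

Lemma ideal_genP s x :
  reflect (exists c : 'I_(size s) -> A, x = \sum_i c i * s`_i)
          (x \in ideal_gen s).
Proof. exact: asboolP. Qed.

Lemma ideal_gen1P u x :
  reflect (exists c, x = c * u) (x \in ideal_gen [:: u]).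
Proof.
apply: (iffP (ideal_genP _ _)) => [[c ->]|[c ->]].
  by exists (c ord0); rewrite big_ord1.
by exists (fun=> c); rewrite big_ord1.
Qed.

Lemma ideal_gen2P u v x :
  reflect (exists c d, x = c * u + d * v) (x \in ideal_gen [:: u; v]).
Proof.
apply: (iffP (ideal_genP _ _)) => [[c ->]|[c [d ->]]].
  by exists (c ord0), (c (lift ord0 ord0)); rewrite big_ord_recl big_ord1.
exists (fun i => if i == ord0 then c else d).
by rewrite big_ord_recl big_ord1.
Qed.

Lemma ideal_gen_idealr s :
  1 \notin ideal_gen s -> idealr_closed (ideal_gen s).
Proof.
move=> proper_s; split=> // [|b u v /ideal_genP[c ->] /ideal_genP[d ->]].
  by apply/ideal_genP; exists (fun=> 0); rewrite big1 // => i _; rewrite mul0r.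
apply/ideal_genP; exists (fun i => b * c i + d i).
rewrite mulr_sumr -big_split; apply: eq_bigr => i _ /=.
by rewrite mulrDl mulrA.
Qed.

Lemma idealrD N u v : idealr_closed N -> u \in N -> v \in N -> u + v \in N.
Proof. by case=> _ _ closedN uN vN; rewrite -[u]mul1r closedN. Qed.

Lemma idealrM N b u : idealr_closed N -> u \in N -> b * u \in N.
Proof. by case=> N0 _ closedN uN; rewrite -[_ * _]addr0 closedN. Qed.

Lemma ideal_gen_sub s N :
  idealr_closed N -> {subset s <= N} -> {subset ideal_gen s <= N}.
Proof.
move=> idN sN x /ideal_genP[c ->].
elim/big_ind: _ => [|u v|i _]; first by case: idN.
  exact: idealrD.
by apply/idealrM/sN/mem_nth.
Qed.

(** Otherwise M + <x> would be a larger ideal, hence contain 1, so that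
    1 - c * x would be in M for some c; but this is a unit, by the geometric
    series. *)
Lemma maximal_ideal_nilpotent M x n :
  maximal_ideal M -> x ^+ n = 0 -> x \in M.
Proof.
move=> [idM maxM] xn0.
pose N : {pred A} := fun y => `[< exists c, y - c * x \in M >].
have NP y : reflect (exists c, y - c * x \in M) (y \in N) by apply: asboolP.
have M0 : 0 \in M by case: idM.
have MN : {subset M <= N}.
  by move=> y yM; apply/NP; exists 0; rewrite mul0r subr0.
have xN : x \in N by apply/NP; exists 1; rewrite mul1r subrr.
rewrite -(maxM N _ MN) //; split; first exact: MN M0.
  apply/negP => /NP[c c_unit]; case: (idM) => _ /negP[].
  (* The right-hand side is a multiple of 1 - c * x. *)
  have -> : 1 = 1 ^+ n - (c * x) ^+ n :> A.
    by rewrite exprMn xn0 mulr0 subr0 expr1n.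
  by rewrite subrXX mulrC idealrM.
move=> b u v /NP[c uc] /NP[d vd]; apply/NP; exists (b * c + d).
have -> : b * u + v - (b * c + d) * x = b * (u - c * x) + (v - d * x).
  by rewrite mulrDl mulrBr mulrA opprD addrACA.
by apply: idealrD => //; apply: idealrM.
Qed.

(** Invertibility modulo M says that A / M is a field: an ideal above M with an
    element x outside M contains 1 = (1 - y * x) + y * x. *)
Lemma maximal_of_inverses M :
    idealr_closed M ->
    (forall x, x \notin M -> exists y, 1 - y * x \in M) ->
  maximal_ideal M.
Proof.
move=> idM invM; split=> // N idN MN x; apply/idP/idP; last exact: MN.
move=> xN; apply: contraT => /invM[y yM]; case: (idN) => _ /negP N1 _; case: N1.
rewrite -(subrK (y * x) 1).
by apply: idealrD => //; [exact: MN | exact: idealrM].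
Qed.

(** Every maximal ideal contains the nilpotent generators of the given maximal
    ideal, hence the whole of it; maximality makes the two coincide. *)
Lemma local_of_nilpotent_gens s :
    1 \notin ideal_gen s ->
    (forall x, x \notin ideal_gen s -> exists y, 1 - y * x \in ideal_gen s) ->
    {in s, forall g, exists n, g ^+ n = 0} ->
  local_with_maximal_ideal (ideal_gen s).
Proof.
move=> proper_s inv_s nil_s; have id_s := ideal_gen_idealr proper_s.
have max_s := maximal_of_inverses id_s inv_s.
split=> // N maxN; have [idN _] := maxN.
apply: max_s.2 => //; apply: ideal_gen_sub => // g /nil_s[n gn0].
exact: maximal_ideal_nilpotent gn0.
Qed.

Lemma jacobson_local M :
  local_with_maximal_ideal M -> jacobson_radical A =i M.
Proof.
move=> [maxM uniqM] x; apply/asboolP/idP => [|xM N /uniqM->//].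
exact.
Qed.

End Ideals.

(** * Lifting polynomials along a ring morphism *)

Section Lifting.
Variables (R S : nzRingType) (bar : {rmorphism R -> S}).

Lemma map_poly_surj :
    (forall y, exists x, bar x = y) ->
  forall q : {poly S}, exists g : {poly R}, map_poly bar g = q.
Proof.
move=> surj; elim/poly_ind => [|q c [g <-]]; first by exists 0; rewrite rmorph0.
have [b <-] := surj c; exists (g * 'X + b%:P).
by rewrite rmorphD rmorphM /= map_polyX map_polyC.
Qed.

Lemma map_poly_ker u :
    (forall x, bar x = 0 -> exists c, x = u * c) ->
  forall g : {poly R}, map_poly bar g = 0 -> exists q, g = u%:P * q.
Proof.
move=> ker; elim/poly_ind => [|g c IHg]; first by exists 0; rewrite mulr0.
rewrite rmorphD rmorphM /= map_polyX map_polyC /= => /polyP bar0.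
have [|q ->] := IHg.
  apply/polyP => i; have := bar0 i.+1.
  by rewrite coefD coefMX coefC addr0 !coef0.
have [|d ->] := ker c.
  by have := bar0 0; rewrite coefD coefMX coefC add0r coef0.
by exists (q * 'X + d%:P); rewrite mulrDr mulrA polyCM.
Qed.

End Lifting.

(** * Quotients by a monic polynomial *)

Section QuotientByMonic.
Variables (R : comNzRingType) (f : {poly R}).
Hypotheses (f_monic : f \is monic) (f_size : (1 < size f)%N).

Let mk_monic_f : mk_monic f = f.
Proof. by rewrite /mk_monic f_size f_monic. Qed.

(** The type of residues replaces an unsuitable modulus by 'X; for f monic and
    not constant it is the quotient by f itself, so that equalities there lift
    to R[x] up to a multiple of f. *)
Lemma in_qpoly_eq g1 g2 :
  in_qpoly f g1 = in_qpoly f g2 -> exists q, g1 = g2 + q * f.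
Proof.
move=> /(congr1 val) /=; rewrite mk_monic_f => eq_mod.
exists (Pdiv.Ring.rdivp g1 f - Pdiv.Ring.rdivp g2 f).
rewrite [LHS](Pdiv.RingMonic.rdivp_eq f_monic) eq_mod.
rewrite [X in _ = X + _](Pdiv.RingMonic.rdivp_eq f_monic).
by rewrite mulrBl [RHS]addrC addrA subrK.
Qed.

Lemma in_qpoly_modulus : in_qpoly f f = 0.
Proof. by apply: val_inj; rewrite /= mk_monic_f Pdiv.RingMonic.rmodpp. Qed.

Lemma in_qpolyK (x : {poly %/ f}) : in_qpoly f (val x) = x.
Proof. by apply/val_inj/in_qpoly_small/size_mk_monic. Qed.

End QuotientByMonic.

(** * The ideal generated by p and h, seen modulo p *)

Section ReductionModP.
Variables (R : comNzRingType) (K : fieldType) (bar : {rmorphism R -> K}).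
Variables (p : nat) (f h : {poly R}).
Hypotheses (bar_surj : forall y, exists x, bar x = y).
Hypothesis bar_ker : forall x, bar x = 0 -> exists c, x = p%:R * c.
Hypothesis bar_p : bar p%:R = 0.

Notation mbar := (map_poly bar).
Notation I := (ideal_gen [:: p%:R : {poly %/ f}; in_qpoly f h]).

Lemma ideal_of_bar_eq0 g : mbar g = 0 -> in_qpoly f g \in I.
Proof.
move=> /(map_poly_ker bar_ker)[q ->].
apply/ideal_gen2P; exists (in_qpoly f q), 0.
by rewrite mul0r addr0 polyC_natr rmorphM rmorph_nat mulrC.
Qed.

(** If g and r * h agree modulo p, then g - r * h is a multiple of p. *)
Lemma in_ideal_of_dvd_bar g : mbar h %| mbar g -> in_qpoly f g \in I.
Proof.
case/dvdpP => q; have [r <-] := map_poly_surj bar_surj q => bar_g.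
have /ideal_of_bar_eq0/ideal_gen2P[c [d eq_cd]] : mbar (g - r * h) = 0.
  by rewrite rmorphB rmorphM /= bar_g subrr.
apply/ideal_gen2P; exists c, (d + in_qpoly f r).
by rewrite mulrDl addrA -eq_cd -rmorphM -rmorphD subrK.
Qed.

(** As h is irreducible modulo p, a Bezout relation a * h + b * g = 1 holds in
    K[x]; a lift r of b is the inverse, 1 - r * g being a multiple of h
    modulo p. *)
Lemma inverse_mod_of_ndvd_bar g :
    irreducible_poly (mbar h) -> ~~ (mbar h %| mbar g) ->
  exists y, 1 - y * in_qpoly f g \in I.
Proof.
move=> irr_h; rewrite -irreducible_poly_coprime //.
case/Bezout_eq1_coprimepP => -[a b] /= bezout.
have [r bar_r] := map_poly_surj bar_surj b.
exists (in_qpoly f r).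
have -> : 1 - in_qpoly f r * in_qpoly f g = in_qpoly f (1 - r * g).
  by rewrite rmorphB rmorph1 rmorphM.
apply: in_ideal_of_dvd_bar.
rewrite rmorphB rmorph1 rmorphM /= bar_r -bezout addrK.
exact: dvdp_mull.
Qed.

(** An element of <p, h> lifts to c * p + d * h + q * f, where p vanishes in K
    and h divides f modulo p. With g = 1 this shows that <p, h> is proper. *)
Lemma in_ideal_dvd_bar g :
    f \is monic -> (1 < size f)%N -> mbar h %| mbar f ->
  in_qpoly f g \in I -> mbar h %| mbar g.
Proof.
move=> f_monic f_size h_dvd_f /ideal_gen2P[c [d]].
rewrite -[c]in_qpolyK -[d]in_qpolyK -(rmorph_nat (in_qpoly f)).
rewrite -!rmorphM -rmorphD.
case/(in_qpoly_eq f_monic f_size) => q ->.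
rewrite !rmorphD !rmorphM /= rmorph_nat -polyC_natr -(rmorph_nat bar) bar_p.
by rewrite mulr0 add0r dvdp_add ?dvdp_mull.
Qed.

End ReductionModP.

(** * The local ring R[x] / <f> *)

Theorem lemma3p1 (p a m : nat) (R : finComNzRingType) (K : finFieldType)
    (bar : {rmorphism R -> K}) (zeta : R) (t : nat) (f h beta : {poly R})
    (p_prime : prime p) (a_gt0 : (0 < a)%N) (m_gt0 : (0 < m)%N)
    (R_galois : galois_ring p a m R)
    (K_residue : residue_field p m bar)
    (zeta_prim : (p ^ m - 1)%N.-primitive_root zeta)
    (f_monic : f \is monic)
    (f_regular : GRing.lreg f)
    (f_primary : primary_elt f)
    (f_nonunit : ~ is_unit f)
    (t_gt0 : (0 < t)%N)
    (h_monic : h \is monic)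
    (h_basic_irr : basic_irreducible bar h)
    (h_teich : h \is a polyOver (teichmuller p m zeta))
    (f_eq : f = h ^+ t + p%:R * beta)
    (deg_beta : (size beta <= t * (size h).-1)%N) :
  local_with_maximal_ideal
    (ideal_gen [:: p%:R : {poly %/ f}; in_qpoly f h]) /\
  jacobson_radical {poly %/ f} =i
    ideal_gen [:: p%:R : {poly %/ f}; in_qpoly f h].
Proof.
have [char_R _ _] := R_galois; have [_ bar_surj bar_ker] := K_residue.
have bar_p : bar p%:R = 0.
  by apply/bar_ker/ideal_gen1P; exists 1; rewrite mul1r.
have bar_kerE x : bar x = 0 -> exists c, x = p%:R * c.
  by move=> /bar_ker/ideal_gen1P[c ->]; exists c; rewrite mulrC.
have [_ irr_h] := h_basic_irr.
(* A constant monic polynomial is 1, a unit. *)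
have f_size : (1 < size f)%N.
  rewrite ltnNge; apply/negP => /size1_polyC f_const; apply: f_nonunit.
  have := monicP f_monic; rewrite {1}f_const lead_coefC => f0_eq1.
  by exists 1; rewrite mulr1 f_const f0_eq1.
have h_dvd_f : map_poly bar h %| map_poly bar f.
  rewrite f_eq rmorphD rmorphM rmorphXn /= rmorph_nat -polyC_natr.
  by rewrite -(rmorph_nat bar) bar_p mul0r addr0 dvdp_exp.
have p_nil : p%:R ^+ a = 0 :> {poly %/ f}.
  have pa0 : (p ^ a)%:R = 0 :> R by apply/char_R.
  rewrite -natrX -(rmorph_nat (in_qpoly f)) -polyC_natr pa0.
  by rewrite polyC0 rmorph0.
have h_nil : in_qpoly f h ^+ (t * a) = 0.
  have : in_qpoly f h ^+ t + p%:R * in_qpoly f beta = 0.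
    rewrite -(rmorph_nat (in_qpoly f)) -rmorphM -rmorphXn -rmorphD -f_eq.
    exact: in_qpoly_modulus f_monic f_size.
  move=> /eqP; rewrite addr_eq0 exprM => /eqP->.
  by rewrite exprNn exprMn p_nil mul0r mulr0.
have loc : local_with_maximal_ideal
             (ideal_gen [:: p%:R : {poly %/ f}; in_qpoly f h]).
  apply: local_of_nilpotent_gens => [|x x_notin|g].
  - rewrite -[X in X \notin _](rmorph1 (in_qpoly f)).
    apply/negP => /(in_ideal_dvd_bar bar_p f_monic f_size h_dvd_f).
    by rewrite rmorph1 dvdp1 gtn_eqF // irr_h.
  - rewrite -[x]in_qpolyK.
    apply: (inverse_mod_of_ndvd_bar f bar_surj bar_kerE irr_h).
    apply: contra x_notin => /(in_ideal_of_dvd_bar f bar_surj bar_kerE).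
    by rewrite in_qpolyK.
  - by rewrite !inE => /orP[] /eqP->; [exists a | exists (t * a)%N].
by split; last exact: jacobson_local.
Qed.
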